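(* Let $\nu$ be a $\rhd$-infinitely divisible probability measure on $\mathbb{R}$ which has an isolated atom at $a\in\mathbb{R}$, i.e. $\nu(\{a\})>0$ and $a\notin\overline{\operatorname{supp}\nu\setminus\{a\}}$. Then $\nu=\nu(\{a\})\delta_a+\nu_{ac}$, where $\nu_{ac}$ is absolutely continuous with respect to Lebesgue measure and $a\notin\operatorname{supp}\nu_{ac}$. Moreover, $$\{u\in\operatorname{supp}\nu\setminus\{a\}:\ \limsup_{v\searrow0}|G_\nu(u+iv)|=\infty\}=\emptyset.$$
   Context: For a probability measure $\mu$ on $\mathbb{R}$, $G_\mu(z)=\int\frac{1}{z-x}d\mu(x)$ for $z\in\mathbb{C}^+$ and $H_\mu=1/G_\mu$. The monotone convolution $\mu\rhd\nu$ is the unique probability measure with $H_{\mu\rhd\nu}=H_\mu\circ H_\nu$; $\mu^{\rhd k}$ is the $k$-fold power. $\nu$ is $\rhd$-infinitely divisible if for every integer $k\ge1$ there is a probability measure $\nu_k$ with $\nu=\nu_k^{\rhd k}$. *)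

(* Defs.v *)
From mathcomp Require Import all_boot all_order all_algebra.
From mathcomp Require Import all_classical all_reals all_analysis.
From mathcomp Require Import complex.
Set Implicit Arguments.
Unset Strict Implicit.
Unset Printing Implicit Defensive.
Import Order.TTheory GRing.Theory Num.Theory numFieldNormedType.Exports.
Local Open Scope classical_set_scope.
Local Open Scope ring_scope.

Section Defs.
Variable R : realType.

(* Cauchy transform G_mu(z) = \int 1/(z - x) dmu(x), z = u + i v, written
   componentwise: 1/(z-x) = ((u-x) - i v) / ((u-x)^2 + v^2). *)
Definition cauchy_re (mu : probability R R) (u v : R) : R :=
  Rintegral mu setT (fun x => (u - x) / ((u - x) ^+ 2 + v ^+ 2)).
Definition cauchy_im (mu : probability R R) (u v : R) : R :=
  Rintegral mu setT (fun x => - v / ((u - x) ^+ 2 + v ^+ 2)).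

Definition cauchy_tr (mu : probability R R) (z : R[i]) : R[i] :=
  let: Complex u v := z in Complex (cauchy_re mu u v) (cauchy_im mu u v).

Definition recip_cauchy (mu : probability R R) (z : R[i]) : R[i] :=
  (cauchy_tr mu z)^-1.

(* rho = mu^{|> k} (k-fold monotone convolution power), characterized as
   the (unique) probability measure with H_rho = H_mu o ... o H_mu (k times)
   on the upper half plane. *)
Definition monotone_power (mu : probability R R) (k : nat)
    (rho : probability R R) : Prop :=
  forall u v : R, 0 < v -> let z := Complex u v in
   recip_cauchy rho z = iter k (recip_cauchy mu) z.

Definition monotone_inf_div (nu : probability R R) : Prop :=
  forall k : nat, (0 < k)%N ->
    exists nuk : probability R R, monotone_power nuk k nu.

Definition oint (x e : R) : set R := `]x - e, x + e[%classic.

Definition msupport (mu : set R -> \bar R) : set R :=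
  [set x : R | forall e : R, 0 < e -> (0 < mu (oint x e))%E].

End Defs.

(* Main.v *)
(* Let [H] be the reciprocal Cauchy transform of [nu], and [f] that of a
   [k]-th monotone root of [nu], so that [H] is the [k]-th iterate of [f].
   With [h z x := f z / (z - x) - 1] one has
   [(f z - z) - (f w - w) = (z - w) * \int h z * h w] and
   [Im (f z - z) = Im z * \int |h z|^2], so Cauchy-Schwarz gives a two-point
   Pick inequality for [f - id].  At a point [p] high on the imaginary axis
   [Im (H p) / Im p] is close to 1; there the Pick inequality keeps the steps
   of the [f]-orbit nearly constant, whence [|f p - p| <= 2 |H p - p| / k].
   This smallness spreads to every orbit as [k] grows, and once
   [Im (f z - z) < Im z] along two orbits the Pick inequality prevents them
   from merging: [H] is injective on the upper half-plane.

   Near the isolated atom [a], [G z = c / (z - a) + g z] with [g] bounded and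
   Lipschitz, and a fixed-point argument shows that [H] maps the points near
   [a] onto all points of the upper half-plane near 0.  By injectivity [H]
   stays away from 0, i.e. [G] is bounded, away from [a].  Boundedness of
   [Im G] bounds [nu] by a multiple of length on intervals off [a]. *)

Require Import Defs.
From mathcomp Require Import all_boot all_order all_algebra.
From mathcomp Require Import all_classical all_reals all_analysis.
From mathcomp Require Import measurable_realfun complex ring lra.
Import Order.TTheory GRing.Theory Num.Theory numFieldNormedType.Exports.
Local Open Scope classical_set_scope.
Local Open Scope ring_scope.
Set Implicit Arguments.
Unset Strict Implicit.
Unset Printing Implicit Defensive.

(** * Dynamics of the Pick inequality *)

Section Dynamics.
Variable R : realType.
Notation C := R[i].
Implicit Types (z w p : C) (f : C -> C).

Local Notation normc := (@Normc.normc R).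

Lemma Im_sub z w : complex.Im (z - w) = complex.Im z - complex.Im w.
Proof. by case: z w => [? ?] [? ?]. Qed.

Lemma normc_ge0 z : 0 <= normc z.
Proof. by case: z => a b /=; exact: sqrtr_ge0. Qed.

Lemma sqr_normc_def z : normc z ^+ 2 = complex.Re z ^+ 2 + complex.Im z ^+ 2.
Proof. by case: z => a b /=; rewrite sqr_sqrtr// addr_ge0 ?sqr_ge0. Qed.

Lemma normc_eq0 z : (normc z == 0) = (z == 0).
Proof.
apply/eqP/eqP => [/Normc.eq0_normc//|->]; exact: Normc.normc0.
Qed.

Lemma normc_gt0 z : (0 < normc z) = (z != 0).
Proof. by rewrite lt_def normc_ge0 andbT normc_eq0. Qed.

Lemma normc_distC z w : normc (z - w) = normc (w - z).
Proof. by rewrite -normcN opprB. Qed.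

Lemma Im_le_normc z : `|complex.Im z| <= normc z.
Proof.
rewrite -ler_sqr ?nnegrE ?normc_ge0// sqr_normc_def real_normK ?num_real//.
by rewrite lerDr sqr_ge0.
Qed.

Lemma Re_le_normc z : `|complex.Re z| <= normc z.
Proof.
rewrite -ler_sqr ?nnegrE ?normc_ge0// sqr_normc_def real_normK ?num_real//.
by rewrite lerDl sqr_ge0.
Qed.

(* For self-maps [f] of the upper half-plane with [f - id] valued in its
   closure, the second clause is the two-point Nevanlinna-Pick condition for
   [f - id]. *)
Definition pick f : Prop :=
  (forall z, 0 < complex.Im z -> complex.Im z <= complex.Im (f z)) /\
  (forall z w, 0 < complex.Im z -> 0 < complex.Im w ->
    normc ((f z - z) - (f w - w)) ^+ 2 * (complex.Im z * complex.Im w) <=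
    normc (z - w) ^+ 2 * (complex.Im (f z - z) * complex.Im (f w - w))).

(* AM-GM with the square root of [p * q * a * b] eliminated. *)
Lemma amgm_bound (A B a b p q : R) : 0 <= A -> 0 <= B -> 0 <= a -> 0 <= b ->
    0 <= p -> 0 <= q -> B ^+ 2 * (a * b) <= A ^+ 2 * (p * q) ->
  2 * B * (a * b) <= A * (a * q + p * b).
Proof.
move=> A0 B0 a0 b0 p0 q0 h.
rewrite -ler_sqr ?nnegrE ?mulr_ge0 ?addr_ge0 ?mulr_ge0//.
have ab0 : 0 <= a * b by rewrite mulr_ge0.
have := ler_wpM2r ab0 h => {}h.
have e : (A * (a * q + p * b)) ^+ 2 - (2 * B * (a * b)) ^+ 2
  = A ^+ 2 * (a * q - p * b) ^+ 2
    + 4 * (A ^+ 2 * (p * q) * (a * b) - B ^+ 2 * (a * b) * (a * b)) by ring.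
rewrite -subr_ge0 e addr_ge0//; first by rewrite mulr_ge0 ?sqr_ge0.
by rewrite mulr_ge0// subr_ge0.
Qed.

(** This is the Schwarz-Pick contraction for [f] itself. The increment of [f] is at most [A + B],
    where [A] is the increment of the identity and [B] that of [f - id]. After squaring,
    [amgm_bound] controls the cross term. *)
Lemma pick_lip f z w : pick f -> 0 < complex.Im z -> 0 < complex.Im w ->
  normc (f z - f w) ^+ 2 * (complex.Im z * complex.Im w) <=
  normc (z - w) ^+ 2 * (complex.Im (f z) * complex.Im (f w)).
Proof.
move=> [f1 f2] z0 w0.
have := f2 _ _ z0 w0; have := f1 _ z0; have := f1 _ w0.
rewrite !Im_sub.
have : normc (f z - f w) <= normc (z - w) + normc (f z - z - (f w - w)).
  have -> : f z - f w = (z - w) + (f z - z - (f w - w)) by ring.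
  exact: le_normcD.
have := normc_ge0 (z - w); have := normc_ge0 (f z - z - (f w - w)).
have := normc_ge0 (f z - f w).
move: (normc _) (normc _) (normc _) => A B N N0 B0 A0 NAB.
set a := complex.Im z in z0 *; set b := complex.Im w in w0 *.
move=> wq zp h.
have := @amgm_bound A B a b (complex.Im (f z) - a) (complex.Im (f w) - b)
  A0 B0 (ltW z0) (ltW w0).
rewrite !subr_ge0 => /(_ zp wq h) h2.
have ab0 : 0 <= a * b by rewrite mulr_ge0// ltW.
apply: (@le_trans _ _ ((A + B) ^+ 2 * (a * b))).
  by rewrite ler_wpM2r// ler_sqr ?nnegrE ?addr_ge0.
have := ler_wpM2l A0 h2 => {}h2.
rewrite -subr_ge0.
set p := complex.Im (f z); set q := complex.Im (f w).
rewrite (_ : _ - _ = (A ^+ 2 * ((p - a) * (q - b)) - B ^+ 2 * (a * b)) +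
    (A * (A * (a * (q - b) + (p - a) * b)) - A * (2 * B * (a * b)))); last by ring.
by rewrite addr_ge0// subr_ge0.
Qed.

Lemma pick_orbit_gt0 f z j : pick f -> 0 < complex.Im z ->
  0 < complex.Im (iter j f z).
Proof.
move=> [f1 _] z0; elim: j => //= j ih; exact: lt_le_trans (f1 _ ih).
Qed.

Lemma pick_orbit_mono f z i j : pick f -> 0 < complex.Im z -> (i <= j)%N ->
  complex.Im (iter i f z) <= complex.Im (iter j f z).
Proof.
move=> pf z0; elim: j => [|j ih]; first by rewrite leqn0 => /eqP ->.
rewrite leq_eqVlt => /orP[/eqP ->//|]; rewrite ltnS => /ih h.
apply: (le_trans h); apply: (proj1 pf); exact: pick_orbit_gt0.
Qed.

Definition jump f z (j : nat) : C := iter j.+1 f z - iter j f z.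

(** By [pick_lip] at consecutive orbit points, the squared length of a step divided by the imaginary
    parts of its two ends never grows along the orbit. The statement is this monotonicity with
    denominators cleared. *)
Lemma jump_ratio f z j : pick f -> 0 < complex.Im z ->
  normc (jump f z j) ^+ 2 * (complex.Im z * complex.Im (f z)) <=
  normc (jump f z 0) ^+ 2 *
    (complex.Im (iter j f z) * complex.Im (iter j.+1 f z)).
Proof.
move=> pf z0; elim: j => // j ih.
have p0 i : 0 < complex.Im (iter i f z) by exact: pick_orbit_gt0.
have := @pick_lip f (iter j.+1 f z) (iter j f z) pf (p0 _) (p0 _).
rewrite -[iter j.+1 f z - iter j f z]/(jump f z j).
rewrite -[f (iter j.+1 f z) - f (iter j f z)]/(jump f z j.+1).
rewrite -[f (iter j.+1 f z)]/(iter j.+2 f z) -[f (iter j f z)]/(iter j.+1 f z).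
move: ih (p0 j) (p0 j.+1) (p0 j.+2) (p0 1%N).
rewrite [iter 1 f z]/=.
move: (normc _ ^+ 2) (normc _ ^+ 2) (normc _ ^+ 2) => sj1 s0 sj.
move: (complex.Im _) (complex.Im _) (complex.Im (iter j.+1 f z))
  (complex.Im (iter j.+2 f z)) z0.
move=> y1 y b c y10 ih.
set a := complex.Im _ in ih * => a0 b0 c0 y0 h.
have h' : sj1 * a <= sj * c by rewrite -(ler_pM2r b0); nra.
rewrite -(ler_pM2r a0).
have := ler_wpM2r (ltW (mulr_gt0 y0 y10)) h'.
have := ler_wpM2r (ltW c0) ih; nra.
Qed.

(** Weakens [jump_ratio] by the monotonicity of imaginary parts, so that one bound serves all steps
    before [k]. *)
Lemma jump_le f z j k : pick f -> 0 < complex.Im z -> (j < k)%N ->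
  normc (jump f z j) * complex.Im z <=
  normc (jump f z 0) * complex.Im (iter k f z).
Proof.
move=> pf z0 jk.
have p0 i : 0 < complex.Im (iter i f z) by exact: pick_orbit_gt0.
have n0 := normc_ge0.
rewrite -ler_sqr ?nnegrE ?mulr_ge0 ?n0// ?(ltW z0) ?(ltW (p0 _))//.
rewrite !exprMn; apply: (@le_trans _ _ (normc (jump f z j) ^+ 2 *
    (complex.Im z * complex.Im (f z)))).
  by rewrite ler_wpM2l ?sqr_ge0// expr2 ler_wpM2l ?(ltW z0)//; apply: (proj1 pf).
apply: (le_trans (jump_ratio j pf z0)); rewrite ler_wpM2l ?sqr_ge0// expr2.
by rewrite ler_pM ?(ltW (p0 _))// pick_orbit_mono// ltnW.
Qed.

(* Summing the two-point inequality along the orbit: the steps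
   can only vary by as much as the imaginary part grows. *)
Lemma jump_variation f z D k j : pick f -> 0 < complex.Im z ->
    (forall i, (i < k)%N -> normc (jump f z i) <= D) -> (j < k)%N ->
  2 * complex.Im z * normc (jump f z j - jump f z 0) <=
  D * ((complex.Im (iter j.+1 f z) - complex.Im (f z)) +
       (complex.Im (iter j f z) - complex.Im z)).
Proof.
move=> pf z0 hD; elim: j => [_|j ih jk].
  by rewrite subrr Normc.normc0 mulr0 /= !subrr addr0 mulr0.
have {}ih := ih (ltnW jk).
have p0 i : 0 < complex.Im (iter i f z) by exact: pick_orbit_gt0.
have hj := hD _ (ltnW jk).
have D0 : 0 <= D := le_trans (normc_ge0 _) hj.
have := proj2 pf _ _ (p0 j.+1) (p0 j).
rewrite -[iter j.+1 f z - iter j f z]/(jump f z j).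
rewrite -[f (iter j.+1 f z) - _]/(jump f z j.+1).
set p := complex.Im (jump f z j.+1); set q := complex.Im (jump f z j).
have p_ge0 : 0 <= p by rewrite /p Im_sub subr_ge0; exact: (proj1 pf).
have q_ge0 : 0 <= q by rewrite /q Im_sub subr_ge0; exact: (proj1 pf).
set B := normc (_ - _) => h.
have B0 : 0 <= B := normc_ge0 _.
have zj i : complex.Im z <= complex.Im (iter i f z).
  exact: (@pick_orbit_mono _ _ 0 i).
have hB : 2 * B * (complex.Im z * complex.Im z) <=
    D * (complex.Im z * q + p * complex.Im z).
  apply: amgm_bound => //; rewrite ?(ltW z0)//.
  apply: (@le_trans _ _ (B ^+ 2 *
    (complex.Im (iter j.+1 f z) * complex.Im (iter j f z)))).
    by rewrite ler_wpM2l ?sqr_ge0// ler_pM ?(ltW z0).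
  apply: (le_trans h); rewrite ler_wpM2r ?mulr_ge0//.
  by rewrite ler_sqr ?nnegrE ?normc_ge0.
have {}hB : 2 * complex.Im z * B <= D * (p + q).
  by rewrite -(ler_pM2r z0); nra.
have : normc (jump f z j.+1 - jump f z 0) <= B + normc (jump f z j - jump f z 0).
  have -> : jump f z j.+1 - jump f z 0 =
    (jump f z j.+1 - jump f z j) + (jump f z j - jump f z 0) by ring.
  exact: le_normcD.
move=> tri; have := ler_wpM2l (ltW z0) tri.
have ep : p = complex.Im (iter j.+2 f z) - complex.Im (iter j.+1 f z).
  by rewrite /p Im_sub.
have eq : q = complex.Im (iter j.+1 f z) - complex.Im (iter j f z).
  by rewrite /q Im_sub.
rewrite ep eq in hB; move: hB ih.
move: (complex.Im z) (complex.Im (f z)) (complex.Im (iter j f z))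
  (complex.Im (iter j.+1 f z)) (complex.Im (iter j.+2 f z)) (normc _) (normc _).
move=> *; nra.
Qed.

(** Little growth of the imaginary part over [k] iterations keeps the steps nearly equal, so their
    sum differs from [k] times the first step by at most half the size of the latter. *)
Lemma root_step_bound f p k : pick f -> 0 < complex.Im p ->
    3 * complex.Im (iter k f p) <= 4 * complex.Im p ->
  k%:R * normc (f p - p) <= 2 * normc (iter k f p - p).
Proof.
move=> pf p0 hY.
set s := normc (f p - p); have s0 : 0 <= s := normc_ge0 _.
have hs i : (i < k)%N -> normc (jump f p i) <= 4 / 3 * s.
  move=> ik; have := jump_le pf p0 ik; rewrite -[normc (jump f p 0)]/s.
  move: (normc _) (complex.Im (iter k f p)) hY => N Y hY h.
  by rewrite -(ler_pM2r p0); have := ler_wpM2l s0 hY; lra.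
(* [jump_variation] with [D = 4 / 3 * s] and a total growth of at most [2 / 3 * Im p] gives
   [4 / 9 * s]. *)
have hd i : (i < k)%N -> normc (jump f p i - (f p - p)) <= s / 2.
  move=> ik; have := jump_variation pf p0 hs ik.
  have := @pick_orbit_mono f p i.+1 k pf p0 ik.
  have := @pick_orbit_mono f p i k pf p0 (ltnW ik).
  have := proj1 pf _ p0.
  rewrite -[jump f p 0]/(f p - p).
  move: (normc _) (complex.Im (f p)) (complex.Im (iter i f p))
    (complex.Im (iter i.+1 f p)) => N y1 yi yi1 h1 h2 h3 h.
  have g : (yi1 - y1) + (yi - complex.Im p) <= 2 / 3 * complex.Im p by lra.
  have := ler_wpM2l s0 g => {}g.
  rewrite -(ler_pM2r p0); nra.
have H i : (i <= k)%N ->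
    normc (iter i f p - p - (f p - p) *+ i) <= i%:R * (s / 2).
  elim: i => [_|i ih ik]; first by rewrite /= subrr mulr0n subr0 Normc.normc0 mul0r.
  have {}ih := ih (ltnW ik).
  have -> : iter i.+1 f p - p - (f p - p) *+ i.+1 =
    (iter i f p - p - (f p - p) *+ i) + (jump f p i - (f p - p)).
    by rewrite /jump mulrSr; ring.
  apply: (le_trans (le_normcD _ _)); rewrite mulrSr mulrDl mul1r.
  exact: lerD (hd _ ik).
have := H k (leqnn k).
have : normc ((f p - p) *+ k) = k%:R * s by rewrite normcMn mulr_natl.
have : normc ((f p - p) *+ k) <= normc (iter k f p - p) +
   normc (iter k f p - p - (f p - p) *+ k).
  set E := _ *+ k; set B := _ - p.
  have -> : normc E = normc (B - (B - E)) by rewrite opprB addrC subrK.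
  by apply: (le_trans (le_normcD _ _)); rewrite normcN.
move=> h1 h2 h3; lra.
Qed.

(* Harnack-type propagation of smallness of [f - id] from one point to
   another. *)
Lemma pick_spread f p z : pick f -> 0 < complex.Im p -> 0 < complex.Im z ->
  normc (f z - z) <=
  (normc (z - p) ^+ 2 / (complex.Im z * complex.Im p) + 2) * normc (f p - p).
Proof.
move=> pf p0 z0.
have zp0 : 0 < complex.Im z * complex.Im p by rewrite mulr_gt0.
set M := _ / _; have M0 : 0 <= M by rewrite divr_ge0 ?sqr_ge0// ltW.
set X := normc (f z - z); set A := normc (f p - p).
have X0 : 0 <= X := normc_ge0 _; have A0 : 0 <= A := normc_ge0 _.
have h : normc ((f z - z) - (f p - p)) ^+ 2 <= M * (X * A).
  rewrite -(ler_pM2r zp0); apply: (le_trans (proj2 pf _ _ z0 p0)).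
  rewrite /M [leRHS]mulrAC divfK ?gt_eqF// ler_wpM2l ?sqr_ge0//.
  have i1 : 0 <= complex.Im (f z - z) by rewrite Im_sub subr_ge0; exact: (proj1 pf).
  have i2 : 0 <= complex.Im (f p - p) by rewrite Im_sub subr_ge0; exact: (proj1 pf).
  by rewrite ler_pM//; exact: le_trans (ler_norm _) (Im_le_normc _).
have tri : X - A <= normc ((f z - z) - (f p - p)).
  rewrite lerBlDr.
  have -> : X = normc ((f z - z - (f p - p)) + (f p - p)) by rewrite subrK.
  exact: le_normcD.
have [XA|AX] := leP X A; first nra.
have : (X - A) ^+ 2 <= M * (X * A).
  apply: le_trans h; rewrite ler_sqr ?nnegrE ?normc_ge0// subr_ge0; exact: ltW.
move=> {}h; have XX : 0 < X by exact: le_lt_trans AX.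
rewrite -(ler_pM2l XX); nra.
Qed.

(** * Injectivity from iterative roots of every order *)

Variables (H : C -> C) (p : C).
Hypothesis Im_p : 0 < complex.Im p.
Hypothesis Hp : 3 * complex.Im (H p) <= 4 * complex.Im p.

(** The threshold [K] must not depend on the root. [root_step_bound] makes the step at [p] of order
    [1 / k], [pick_spread] carries this to [z], and [jump_le] to the later steps from [z]. *)
Lemma root_small_steps z : 0 < complex.Im z ->
  exists K : R, forall f (k : nat), K < k%:R -> pick f ->
    (forall w, 0 < complex.Im w -> H w = iter k f w) ->
    forall j, (j < k)%N -> complex.Im (jump f z j) < complex.Im z.
Proof.
move=> z0; set M := normc (z - p) ^+ 2 / (complex.Im z * complex.Im p) + 2.
exists (M * (2 * normc (H p - p)) * complex.Im (H z) / complex.Im z ^+ 2).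
move=> f k; rewrite ltr_pdivrMr ?exprn_gt0// => hk pf hH j jk.
have k0 : 0 < k%:R :> R by rewrite ltr0n; exact: leq_ltn_trans jk.
have M0 : 0 <= M.
  by rewrite addr_ge0// divr_ge0 ?sqr_ge0// ltW// mulr_gt0.
have h1 : k%:R * normc (f p - p) <= 2 * normc (H p - p).
  by rewrite hH//; apply: root_step_bound => //; rewrite -hH.
have h2 : normc (f z - z) <= M * normc (f p - p) by exact: pick_spread.
have := jump_le pf z0 jk; rewrite -hH// -[jump f z 0]/(f z - z) => h3.
have Y0 : 0 <= complex.Im (H z).
  by rewrite hH//; apply: ltW; exact: pick_orbit_gt0.
have : normc (jump f z j) < complex.Im z.
  rewrite -(ltr_pM2r z0) -(ltr_pM2l k0) -expr2; apply: le_lt_trans hk.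
  apply: (le_trans (ler_wpM2l (ltW k0) h3)).
  rewrite [leLHS]mulrA ler_wpM2r//.
  apply: (le_trans (ler_wpM2l (ltW k0) h2)).
  by rewrite mulrCA ler_wpM2l.
by apply: le_lt_trans; exact: le_trans (ler_norm _) (Im_le_normc _).
Qed.

Hypothesis H_roots : forall k, (0 < k)%N ->
  exists2 f, pick f & forall z, 0 < complex.Im z -> H z = iter k f z.

(** One root [f] of large order suffices: equal values of [H] would mean that the two [f]-orbits
    agree at step [k], while small steps keep distinct orbits distinct from each step to the
    next. *)
Lemma pick_roots_injective z w : 0 < complex.Im z -> 0 < complex.Im w ->
  H z = H w -> z = w.
Proof.
move=> z0 w0 Hzw; apply/eqP/negPn/negP => zw.
have [K1 hK1] := root_small_steps z0; have [K2 hK2] := root_small_steps w0.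
pose k := (Num.truncn (Num.max K1 K2)).+1.
have : Num.max K1 K2 < k%:R by exact: truncnS_gt.
rewrite gt_max => /andP[kK1 kK2].
have [f pf hf] := H_roots (ltn0Sn (Num.truncn (Num.max K1 K2))).
have {hK1}s1 := hK1 f k kK1 pf hf; have {hK2}s2 := hK2 f k kK2 pf hf.
suff : forall j, (j <= k)%N -> iter j f z != iter j f w.
  by move=> /(_ k (leqnn k)); rewrite -hf// -hf// Hzw eqxx.
elim=> // j ih jk; have {}ih := ih (ltnW jk).
have p0 u i : 0 < complex.Im u -> 0 < complex.Im (iter i f u).
  by move=> u0; exact: pick_orbit_gt0.
apply/negP => /eqP e.
(* If the orbits met at step [j.+1], their jumps would differ by minus the present gap. The gap then
   cancels, and the product of the imaginary parts is at most the product of their increments, which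
   are smaller. *)
have := proj2 pf _ _ (p0 _ j z0) (p0 _ j w0).
rewrite -[f (iter j f z)]/(iter j.+1 f z) e -[f (iter j f w)]/(iter j.+1 f w).
rewrite [X in normc X ^+ 2](_ : _ = - (iter j f z - iter j f w)); last by ring.
rewrite normcN ler_pM2l; last by rewrite exprn_gt0// normc_gt0 subr_eq0.
apply/negP; rewrite -ltNge -{1}e.
have Ige u : 0 < complex.Im u ->
    0 <= complex.Im (iter j.+1 f u - iter j f u).
  by move=> u0; rewrite Im_sub subr_ge0; apply: (proj1 pf); exact: p0.
have lt1 := lt_le_trans (s1 j jk) (@pick_orbit_mono f z 0 j pf z0 (leq0n j)).
have lt2 := lt_le_trans (s2 j jk) (@pick_orbit_mono f w 0 j pf w0 (leq0n j)).
by apply: ltr_pM => //; exact: Ige.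
Qed.

End Dynamics.

(** * Complex-valued integrals *)

Section ComplexIntegral.
Variables (R : realType) (mu : probability R R).
Notation C := R[i].
Local Notation normc := (@Normc.normc R).
Local Notation Re := (@complex.Re R).
Local Notation Im := (@complex.Im R).

(** Boundedness stands in for integrability: it is stable under products and implies integrability
    against a probability measure. *)
Definition bmfun (f : R -> C) : Prop :=
  [/\ measurable_fun setT (Re \o f), measurable_fun setT (Im \o f) &
      exists M, forall x, normc (f x) <= M].

Definition cint (f : R -> C) : C :=
  Complex (Rintegral mu setT (Re \o f)) (Rintegral mu setT (Im \o f)).

Lemma eq_bmfun f g : f =1 g -> bmfun f -> bmfun g.
Proof. by move=> /funext ->. Qed.

Lemma eq_cint f g : f =1 g -> cint f = cint g.
Proof. by move=> /funext ->. Qed.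

Lemma bmfun_cst c : bmfun (fun=> c).
Proof.
by split; [exact: measurable_cst|exact: measurable_cst|exists (normc c)].
Qed.

Lemma bmfunD f g : bmfun f -> bmfun g -> bmfun (fun x => f x + g x).
Proof.
move=> [f1 f2 [M hM]] [g1 g2 [N hN]]; split.
- rewrite (_ : _ \o _ = (Re \o f) \+ (Re \o g)); first exact: measurable_funD.
  by apply/funext => x /=; case: (f x) (g x) => [? ?] [? ?].
- rewrite (_ : _ \o _ = (Im \o f) \+ (Im \o g)); first exact: measurable_funD.
  by apply/funext => x /=; case: (f x) (g x) => [? ?] [? ?].
- by exists (M + N) => x; apply: (le_trans (le_normcD _ _)); exact: lerD.
Qed.

Lemma bmfunM f g : bmfun f -> bmfun g -> bmfun (fun x => f x * g x).
Proof.
move=> [f1 f2 [M hM]] [g1 g2 [N hN]]; split.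
- rewrite (_ : _ \o _ = (((Re \o f) \* (Re \o g)) \- ((Im \o f) \* (Im \o g)))).
    by apply: measurable_funB; exact: measurable_funM.
  by apply/funext => x /=; case: (f x) (g x) => [? ?] [? ?].
- rewrite (_ : _ \o _ = (((Re \o f) \* (Im \o g)) \+ ((Im \o f) \* (Re \o g)))).
    by apply: measurable_funD; exact: measurable_funM.
  by apply/funext => x /=; case: (f x) (g x) => [? ?] [? ?].
- exists (M * N) => x; rewrite Normc.normcM.
  by rewrite ler_pM// normc_ge0.
Qed.

Lemma bmfun_conj f : bmfun f -> bmfun (fun x => conjc (f x)).
Proof.
move=> [f1 f2 [M hM]]; split.
- rewrite (_ : _ \o _ = Re \o f)//.
  by apply/funext => x /=; case: (f x).
- rewrite (_ : _ \o _ = \- (Im \o f)); first exact: measurable_funN.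
  by apply/funext => x /=; case: (f x).
- exists M => x; rewrite (_ : normc (conjc (f x)) = normc (f x))//.
  by case: (f x) => a b /=; rewrite sqrrN.
Qed.

Lemma bmfunZ c f : bmfun f -> bmfun (fun x => c * f x).
Proof. exact: bmfunM (bmfun_cst c). Qed.

Lemma bmfunN f : bmfun f -> bmfun (fun x => - f x).
Proof.
move=> bf; apply: eq_bmfun (bmfunZ (- 1) bf) => x.
by rewrite mulN1r.
Qed.

Lemma bmfunB f g : bmfun f -> bmfun g -> bmfun (fun x => f x - g x).
Proof. by move=> bf bg; exact: bmfunD (bmfunN bg). Qed.

Lemma bounded_measurable_integrable (h : R -> R) M :
  measurable_fun setT h -> (forall x, `|h x| <= M) ->
  mu.-integrable setT (EFin \o h).
Proof.
move=> mh hM; apply: measurable_bounded_integrable => //.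
  by apply: (le_lt_trans (probability_le1 mu measurableT)); exact: ltry.
exists M; split; first by rewrite num_real.
by move=> N MN x _; apply: le_trans (hM x) (ltW MN).
Qed.

Lemma bmfun_Re f : bmfun f -> mu.-integrable setT (EFin \o (Re \o f)).
Proof.
move=> [f1 _ [M hM]]; apply: (@bounded_measurable_integrable _ M) => // x.
exact: le_trans (Re_le_normc _) (hM x).
Qed.

Lemma bmfun_Im f : bmfun f -> mu.-integrable setT (EFin \o (Im \o f)).
Proof.
move=> [_ f1 [M hM]]; apply: (@bounded_measurable_integrable _ M) => // x.
exact: le_trans (Im_le_normc _) (hM x).
Qed.

Lemma cintD f g : bmfun f -> bmfun g ->
  cint (fun x => f x + g x) = cint f + cint g.
Proof.
move=> bf bg; apply/eqP; rewrite eq_complex /=; apply/andP; split; apply/eqP.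
- rewrite -RintegralD//; try exact: bmfun_Re.
  by apply: eq_Rintegral => x _ /=; case: (f x) (g x) => [? ?] [? ?].
- rewrite -RintegralD//; try exact: bmfun_Im.
  by apply: eq_Rintegral => x _ /=; case: (f x) (g x) => [? ?] [? ?].
Qed.

Lemma cintZ c f : bmfun f -> cint (fun x => c * f x) = c * cint f.
Proof.
move=> bf; have [i1 i2] := (bmfun_Re bf, bmfun_Im bf).
have Z r h : mu.-integrable setT (EFin \o h) ->
    mu.-integrable setT (EFin \o (fun x => r * h x)).
  by move=> ih; apply: eq_integrable (integrableZl measurableT r ih).
case: c => a b; apply/eqP; rewrite eq_complex /=; apply/andP; split; apply/eqP.
- rewrite -RintegralZl// -RintegralZl// -RintegralB//; try exact: Z.
  by apply: eq_Rintegral => x _ /=; case: (f x).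
- rewrite -RintegralZl// -RintegralZl// -RintegralD//; try exact: Z.
  by apply: eq_Rintegral => x _ /=; case: (f x).
Qed.

Lemma Rintegral_probability_cst (r : R) : Rintegral mu setT (fun=> r) = r.
Proof.
rewrite Rintegral_cst// -[RHS]mulr1; congr (_ * _).
exact: (congr1 fine (probability_setT mu)).
Qed.

Lemma cint_cst c : cint (fun=> c) = c.
Proof.
case: c => a b; rewrite /cint /comp /=.
by rewrite !Rintegral_probability_cst.
Qed.

Lemma cintB f g : bmfun f -> bmfun g ->
  cint (fun x => f x - g x) = cint f - cint g.
Proof.
move=> bf bg; rewrite cintD//; last exact: bmfunN.
congr (_ + _); rewrite -mulN1r -cintZ//; apply: eq_cint => x.
by rewrite mulN1r.
Qed.

Lemma cint_conj f : bmfun f -> cint (fun x => conjc (f x)) = conjc (cint f).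
Proof.
move=> bf; apply/eqP; rewrite eq_complex /=; apply/andP; split; apply/eqP.
- by apply: eq_Rintegral => x _ /=; case: (f x).
- rewrite -mulN1r -RintegralZl//; last exact: bmfun_Im.
  by apply: eq_Rintegral => x _ /=; case: (f x) => ? ? /=; rewrite mulN1r.
Qed.

Definition L2sq (f : R -> C) : R := Rintegral mu setT (fun x => normc (f x) ^+ 2).

Lemma mul_conjc z : z * conjc z = (normc z ^+ 2)%:C%C.
Proof.
case: z => a b; rewrite sqr_normc_def.
by apply/eqP; rewrite eq_complex /=; apply/andP; split; apply/eqP; ring.
Qed.

Lemma cint_mul_conj f : cint (fun x => f x * conjc (f x)) = (L2sq f)%:C%C.
Proof.
rewrite (@eq_cint _ (fun x => (normc (f x) ^+ 2)%:C%C)); last first.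
  by move=> x; rewrite mul_conjc.
by rewrite /cint /comp /= Rintegral_probability_cst.
Qed.

Lemma L2sq_ge0 f : 0 <= L2sq f.
Proof. by apply: Rintegral_ge0 => x _; exact: sqr_ge0. Qed.

Lemma sqr_normc_measurable f : bmfun f ->
  measurable_fun setT (fun x => normc (f x) ^+ 2).
Proof.
move=> [f1 f2 _].
rewrite (_ : (fun _ => _) = ((Re \o f) \* (Re \o f)) \+ ((Im \o f) \* (Im \o f))).
  by apply: measurable_funD; exact: measurable_funM.
by apply/funext => x /=; rewrite sqr_normc_def !expr2.
Qed.

Lemma L2sq_le f M : bmfun f -> (forall x, normc (f x) <= M) -> L2sq f <= M ^+ 2.
Proof.
move=> bf hM.
rewrite -[leRHS]Rintegral_probability_cst.
have M0 : 0 <= M by exact: le_trans (normc_ge0 _) (hM 0).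
have h x : normc (f x) ^+ 2 <= M ^+ 2 by rewrite ler_sqr ?nnegrE ?normc_ge0.
apply: le_Rintegral => //.
- apply: (@bounded_measurable_integrable _ (M ^+ 2)).
    exact: sqr_normc_measurable.
  by move=> x; rewrite ger0_norm ?sqr_ge0.
- apply: (@bounded_measurable_integrable _ (M ^+ 2)) => // x.
  by rewrite ger0_norm ?sqr_ge0.
Qed.

(** The integral of [|f - r * S * conj g|^2] is nonnegative for every real [r]. The factor [S]
    supplies the phase, so real [r] is enough, and [r = 1 / L2sq g] is optimal. *)
Lemma cint_CauchySchwarz f g : bmfun f -> bmfun g ->
  normc (cint (fun x => f x * g x)) ^+ 2 <= L2sq f * L2sq g.
Proof.
move=> bf bg; have [cf cg] := (bmfun_conj bf, bmfun_conj bg).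
set S := cint _.
have key (r : R) :
    0 <= L2sq f - 2 * r * normc S ^+ 2 + r ^+ 2 * normc S ^+ 2 * L2sq g.
  set t : C := r%:C%C * S.
  have := L2sq_ge0 (fun x => f x - t * conjc (g x)).
  suff -> : L2sq (fun x => f x - t * conjc (g x)) =
      L2sq f - 2 * r * normc S ^+ 2 + r ^+ 2 * normc S ^+ 2 * L2sq g by [].
  apply: (@complexI R); rewrite -cint_mul_conj.
  rewrite (@eq_cint _ (fun x => (f x * conjc (f x) +
    - conjc t * (f x * g x)) + (- t * conjc (f x * g x) +
    (t * conjc t) * (g x * conjc (g x))))); last first.
    by move=> x; rewrite rmorphB !rmorphM /= !conjcK; ring.
  have b1 := bmfunM bf cf; have b2 := bmfunM bf bg.
  have b3 := bmfun_conj b2; have b4 := bmfunM bg cg.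
  rewrite cintD; last first.
  - exact: bmfunD (bmfunZ _ b3) (bmfunZ _ b4).
  - exact: bmfunD (bmfunZ _ b2).
  rewrite cintD//; last exact: bmfunZ.
  rewrite cintD//; [|exact: bmfunZ|exact: bmfunZ].
  rewrite !cintZ// cint_conj// -/S !cint_mul_conj.
  have -> : (L2sq f - 2 * r * normc S ^+ 2 + r ^+ 2 * normc S ^+ 2 * L2sq g)%:C%C =
    (L2sq f)%:C%C - 2 * r%:C%C * (normc S ^+ 2)%:C%C +
    r%:C%C ^+ 2 * (normc S ^+ 2)%:C%C * (L2sq g)%:C%C.
    rewrite rmorphD rmorphB (rmorphM _ (2 * r)) (rmorphM _ 2) rmorph_nat.
    by rewrite (rmorphM _ _ (L2sq g)) (rmorphM _ (r ^+ 2)) (rmorphXn _ 2 r).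
  have -> : conjc t = r%:C%C * conjc S by rewrite rmorphM /= oppr0.
  by rewrite -mul_conjc /t; ring.
have P0 := L2sq_ge0 f; have Q0 := L2sq_ge0 g.
have s0 : 0 <= normc S ^+ 2 by exact: sqr_ge0.
move: (normc S ^+ 2) (L2sq f) (L2sq g) key s0 P0 Q0 => s P Q key s0 P0.
rewrite le_eqVlt => /predU1P[Q0|Q0].
  have [|sp] := eqVneq s 0; first by move->; rewrite -Q0 mulr0.
  have {sp}s0 : 0 < s by rewrite lt_def sp.
  (* When [L2sq g] vanishes the expression is affine in [r]; this value of [r] makes it [- 1]. *)
  have := key ((P + 1) / (2 * s)); rewrite -Q0 mulr0 addr0.
  rewrite (_ : P - _ = - 1); last by field; rewrite gt_eqF.
  by rewrite oppr_ge0 ler10.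
have := key Q^-1.
rewrite (_ : _ + _ = (P * Q - s) / Q); last by field; rewrite gt_eqF.
by rewrite pmulr_lge0 ?invr_gt0// subr_ge0.
Qed.

(** Cauchy-Schwarz against the constant 1, using that the total mass is 1. *)
Lemma normc_cint_le f M : bmfun f -> (forall x, normc (f x) <= M) ->
  normc (cint f) <= M.
Proof.
move=> bf hM; have M0 : 0 <= M by exact: le_trans (normc_ge0 _) (hM 0).
rewrite -ler_sqr ?nnegrE ?normc_ge0//.
rewrite (@eq_cint _ (fun x => f x * 1)); last by move=> x; rewrite mulr1.
apply: (le_trans (cint_CauchySchwarz bf (bmfun_cst 1))).
rewrite -[leRHS]mulr1 ler_pM ?L2sq_ge0//; first exact: L2sq_le.
rewrite -[leRHS](expr1n _ 2); apply: L2sq_le; first exact: bmfun_cst.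
by move=> _; rewrite Normc.normc1.
Qed.

End ComplexIntegral.

(** * Reciprocal Cauchy transforms *)

Section CauchyKernel.
Variable R : realType.
Notation C := R[i].
Local Notation normc := (@Normc.normc R).
Local Notation Re := (@complex.Re R).
Local Notation Im := (@complex.Im R).

Definition cker (z : C) (x : R) : C := (z - x%:C%C)^-1.

Lemma cker_re z x : Re (cker z x) = (Re z - x) / ((Re z - x) ^+ 2 + Im z ^+ 2).
Proof. by case: z => u v /=; rewrite oppr0 addr0. Qed.

Lemma cker_im z x : Im (cker z x) = - Im z / ((Re z - x) ^+ 2 + Im z ^+ 2).
Proof. by case: z => u v /=; rewrite oppr0 addr0 mulNr. Qed.

Lemma sqr_normc_cker z x :
  normc (cker z x) ^+ 2 = ((Re z - x) ^+ 2 + Im z ^+ 2)^-1.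
Proof.
rewrite /cker Normc.normcV exprVn sqr_normc_def.
by case: z => u v /=; rewrite oppr0 addr0.
Qed.

(** The inverse is rewritten as the real power with exponent [- 1], which is measurable and agrees
    with it on nonnegative values. *)
Lemma measurable_funV (h : R -> R) : measurable_fun setT h ->
  (forall x, 0 <= h x) -> measurable_fun setT (fun x => (h x)^-1).
Proof.
move=> mh h0; rewrite (_ : (fun _ => _) = (@powR R ^~ (- 1)) \o h).
  exact: measurableT_comp (measurable_powR _) mh.
by apply/funext => x /=; rewrite powR_inv1.
Qed.

Lemma measurable_cker z :
  measurable_fun setT (Re \o cker z) /\ measurable_fun setT (Im \o cker z).
Proof.
have md : measurable_fun setT (fun x : R => Re z - x) by exact: measurable_funB.
have mi : measurable_fun setT
    (fun x : R => ((Re z - x) ^+ 2 + Im z ^+ 2)^-1).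
  apply: measurable_funV; last by move=> x; rewrite addr_ge0 ?sqr_ge0.
  by apply: measurable_funD => //; exact: measurable_funX.
split.
- rewrite (_ : _ \o _ = (fun x : R => Re z - x) \*
    (fun x : R => ((Re z - x) ^+ 2 + Im z ^+ 2)^-1)).
    exact: measurable_funM.
  by apply/funext => x; exact: cker_re.
- rewrite (_ : _ \o _ = (fun x : R => - Im z) \*
    (fun x : R => ((Re z - x) ^+ 2 + Im z ^+ 2)^-1)).
    exact: measurable_funM.
  by apply/funext => x; exact: cker_im.
Qed.

Lemma sub_real_neq0 z x : Im z != 0 -> z - x%:C%C != 0.
Proof.
apply: contraNneq => /(congr1 Im); case: z => u v /=.
by rewrite oppr0 addr0 => ->.
Qed.

Lemma bmfun_cker z : Im z != 0 -> bmfun (cker z).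
Proof.
move=> z0; have [m1 m2] := measurable_cker z; split => //.
exists `|Im z|^-1 => x; rewrite /cker Normc.normcV lef_pV2 ?posrE ?normr_gt0//.
  apply: le_trans (Im_le_normc _).
  by case: z {z0 m1 m2} => ? ? /=; rewrite oppr0 addr0.
by rewrite normc_gt0; exact: sub_real_neq0.
Qed.

(** The resolvent identity, from which the difference formulas for [G] and [H] follow by
    integration. *)
Lemma cker_sub (z w : C) x : z - x%:C%C != 0 -> w - x%:C%C != 0 ->
  cker z x - cker w x = (w - z) * (cker z x * cker w x).
Proof. by rewrite /cker => z0 w0; field; rewrite z0 w0. Qed.

Lemma cker_conj z x : conjc (cker z x) = cker (conjc z) x.
Proof. by rewrite /cker conjc_inv rmorphB /= oppr0. Qed.

Lemma Im_conjc z : Im (conjc z) = - Im z.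
Proof. by case: z. Qed.

Lemma Im_inv (z : C) : Im (z^-1) = - Im z * normc (z^-1) ^+ 2.
Proof.
by rewrite Normc.normcV exprVn sqr_normc_def; case: z => a b /=; rewrite mulNr.
Qed.

Variable mu : probability R R.
Notation G := (cauchy_tr mu).
Notation H := (recip_cauchy mu).

Lemma cauchy_trE z : G z = cint mu (cker z).
Proof.
case: z => u v; apply/eqP; rewrite eq_complex /=; apply/andP; split; apply/eqP.
- by apply: eq_Rintegral => x _; rewrite /= oppr0 addr0.
- by apply: eq_Rintegral => x _; rewrite /= oppr0 addr0 mulNr.
Qed.

Lemma cauchy_tr_sub z w : Im z != 0 -> Im w != 0 ->
  G z - G w = (w - z) * cint mu (fun x => cker z x * cker w x).
Proof.
move=> z0 w0; have [bz bw] := (bmfun_cker z0, bmfun_cker w0).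
rewrite !cauchy_trE -cintB// -cintZ; last exact: bmfunM.
by apply: eq_cint => x; rewrite cker_sub// sub_real_neq0.
Qed.

(** The difference formula at [z] and its conjugate, since [G] commutes with conjugation. *)
Lemma Im_cauchy_tr z : Im z != 0 -> Im (G z) = - Im z * L2sq mu (cker z).
Proof.
move=> z0; have zc0 : Im (conjc z) != 0 by rewrite Im_conjc oppr_eq0.
have := cauchy_tr_sub z0 zc0.
rewrite (@eq_cint _ _ _ (fun x => cker z x * conjc (cker z x))); last first.
  by move=> x; rewrite cker_conj.
rewrite cint_mul_conj.
have -> : G (conjc z) = conjc (G z).
  rewrite !cauchy_trE -cint_conj; last exact: bmfun_cker.
  by apply: eq_cint => x; rewrite cker_conj.
move/(congr1 Im); move: (L2sq _ _) (G z) => L [a b]; case: z {z0 zc0} => u v /=.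
by rewrite mulr0 add0r => h; lra.
Qed.

(** Markov's inequality; the upper bound [M] makes [h] integrable. *)
Lemma Rintegral_ge_indic (h : R -> R) (A : set R) (c M : R) :
  measurable A -> measurable_fun setT h -> (forall x, 0 <= h x <= M) ->
  0 <= c -> (forall x, A x -> c <= h x) ->
  c * fine (mu A) <= Rintegral mu setT h.
Proof.
move=> mA mh hM c0 hc.
have iA : mu.-integrable setT (EFin \o (\1_A : R -> R)).
  apply: (@bounded_measurable_integrable _ _ _ 1); first exact: measurable_indic.
  by move=> x; rewrite indicE; case: (_ \in _); rewrite ?normr1 ?normr0.
have ih : mu.-integrable setT (EFin \o h).
  apply: (@bounded_measurable_integrable _ _ _ M) => // x.
  by have /andP[h0 h1] := hM x; rewrite ger0_norm.
have -> : c * fine (mu A) = Rintegral mu setT (fun x => c * \1_A x).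
  rewrite RintegralZl//; congr (_ * fine _).
  by rewrite integral_indic// setIT.
apply: le_Rintegral => //.
  by apply: eq_integrable (integrableZl measurableT c iA).
move=> x _; rewrite indicE; have [/set_mem Ax|_] := boolP (x \in A).
  by rewrite mulr1; exact: hc.
by rewrite mulr0; have /andP[] := hM x.
Qed.

(** Continuity from below along the intervals [[-n, n]]. *)
Lemma probability_itv_ge (c : R) : c < 1 ->
  exists2 m : R, 0 < m & c <= fine (mu `[- m, m]%classic).
Proof.
move=> c1; pose F (n : nat) : set R := `[- (n%:R : R), n%:R]%classic.
have mF n : measurable (F n) by exact: measurable_itv.
have UT : \bigcup_n F n = setT.
  apply/seteqP; split => // x _; exists (Num.truncn `|x|).+1 => //.
  by rewrite /F /= in_itv /= -ler_norml ltW// truncnS_gt.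
have cv : mu \o F @ \oo --> 1%E.
  rewrite -(probability_setT mu : mu _ = 1%E) -UT.
  apply: nondecreasing_cvg_mu => //; first exact: bigcupT_measurable.
  move=> i j ij; apply/subsetPset => x; rewrite /F /= !in_itv /= => /andP[h1 h2].
  by rewrite (le_trans _ h1) ?lerN2 ?ler_nat//= (le_trans h2)// ler_nat.
have : nbhs 1%E [set y : \bar R | (c%:E < y)%E].
  by apply: open_nbhs_nbhs; split; [exact: open_ereal_gt_ereal|rewrite /= lte_fin].
move=> /cv [N _ /(_ N.+1 (leqnSn N))] /= h; exists N.+1%:R => //.
rewrite -lee_fin fineK; first exact: ltW.
by rewrite ge0_fin_numE// (le_lt_trans (probability_le1 mu (mF _)))// ltry.
Qed.

Lemma sqr_normc_cker_bound z x : Im z != 0 ->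
  0 <= normc (cker z x) ^+ 2 <= (Im z ^+ 2)^-1.
Proof.
move=> z0; rewrite sqr_ge0 /= sqr_normc_cker.
by rewrite lef_pV2 ?posrE ?lerDr ?sqr_ge0// ?ltr_wpDl ?sqr_ge0// exprn_even_gt0.
Qed.

(** The last hypothesis says that [c] bounds the squared modulus of the kernel from below on [A],
    written without division. *)
Lemma L2sq_cker_ge z (A : set R) c : Im z != 0 -> measurable A -> 0 <= c ->
  (forall x, A x -> c * ((Re z - x) ^+ 2 + Im z ^+ 2) <= 1) ->
  c * fine (mu A) <= L2sq mu (cker z).
Proof.
move=> z0 mA c0 hc; apply: (@Rintegral_ge_indic _ _ _ (Im z ^+ 2)^-1) => //.
- by apply: sqr_normc_measurable; exact: bmfun_cker.
- by move=> x; exact: sqr_normc_cker_bound.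
move=> x /hc; rewrite sqr_normc_cker => h.
have d0 : 0 < (Re z - x) ^+ 2 + Im z ^+ 2.
  by rewrite ltr_wpDl ?sqr_ge0// exprn_even_gt0.
by rewrite -(ler_pM2r d0) mulVf// gt_eqF.
Qed.

Lemma L2sq_cker_gt0 z : Im z != 0 -> 0 < L2sq mu (cker z).
Proof.
move=> z0; have [m m0 hm] := @probability_itv_ge (1 / 2) ltac:(lra).
pose d := (`|Re z| + m) ^+ 2 + Im z ^+ 2.
have d0 : 0 < d by rewrite ltr_wpDl ?sqr_ge0// exprn_even_gt0.
have h : d^-1 * fine (mu `[- m, m]%classic) <= L2sq mu (cker z).
  apply: L2sq_cker_ge => //; first by rewrite invr_ge0 ltW.
  move=> x /=; rewrite in_itv /= -ler_norml => xm.
  rewrite -(ler_pM2l d0) mulrA mulfV ?gt_eqF// mul1r mulr1 lerD2r.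
  rewrite -(real_normK (num_real (Re z - x))) ler_sqr ?nnegrE//.
    by apply: (le_trans (ler_normB _ _)); rewrite lerD2l.
  by rewrite addr_ge0// ltW.
apply: lt_le_trans h; rewrite mulr_gt0 ?invr_gt0//.
by apply: lt_le_trans hm; lra.
Qed.

Lemma cauchy_tr_neq0 z : Im z != 0 -> G z != 0.
Proof.
move=> z0; apply/negP => /eqP /(congr1 Im); rewrite Im_cauchy_tr//= => /eqP.
by rewrite mulf_eq0 oppr_eq0 (negbTE z0) gt_eqF// L2sq_cker_gt0.
Qed.

(** Expand the product and use [H * G = 1]: the integral becomes [H z * H w * K - 1], where
    [(w - z) * K = G z - G w] by the resolvent identity, and
    [H z * H w * (G z - G w) = H w - H z]. *)
Lemma recip_sub_kernel z w : Im z != 0 -> Im w != 0 ->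
  (H z - z) - (H w - w) =
  (z - w) * cint mu (fun x => (H z * cker z x - 1) * (H w * cker w x - 1)).
Proof.
move=> z0 w0; have [bz bw] := (bmfun_cker z0, bmfun_cker w0).
rewrite (@eq_cint _ _ _ (fun x => (H z * H w) * (cker z x * cker w x) -
    (H z * cker z x + (H w * cker w x - 1)))); last by move=> x; ring.
have b1 := bmfun_cst (1 : C); have bzw := bmfunM bz bw.
have b2 := bmfunB (bmfunZ (H w) bw) b1.
rewrite cintB; [|exact: bmfunZ|exact: bmfunD (bmfunZ _ bz) b2].
rewrite cintD; [|exact: bmfunZ|exact: b2].
rewrite cintB; [|exact: bmfunZ|exact: b1].
rewrite !cintZ// cint_cst -!cauchy_trE.
have := cauchy_tr_sub z0 w0; set K := cint _ _ => eK.
have -> : (z - w) * (H z * H w * K - (H z * G z + (H w * G w - 1))) =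
   (z - w) * - (H z * G z + (H w * G w - 1)) - H z * H w * ((w - z) * K) by ring.
rewrite -eK /recip_cauchy.
have gz := cauchy_tr_neq0 z0; have gw := cauchy_tr_neq0 w0.
by field; rewrite gz gw.
Qed.

(** Since [H z * G z = 1], the terms other than the leading square integrate to [- 1]; the leading
    one is read off from the imaginary part of [1 / G z]. *)
Lemma Im_recip_sub z : Im z != 0 ->
  Im (H z - z) = Im z * L2sq mu (fun x => H z * cker z x - 1).
Proof.
move=> z0; have bz := bmfun_cker z0; have b1 := bmfun_cst (1 : C).
have gz := cauchy_tr_neq0 z0.
have -> : L2sq mu (fun x => H z * cker z x - 1) =
    normc (H z) ^+ 2 * L2sq mu (cker z) - 1.
  apply: (@complexI R); rewrite -cint_mul_conj rmorphB rmorphM rmorph1 /=.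
  rewrite -mul_conjc -cint_mul_conj.
  rewrite (@eq_cint _ _ _ (fun x =>
    (H z * conjc (H z)) * (cker z x * conjc (cker z x)) -
    (H z * cker z x + (conjc (H z * cker z x) - 1)))); last first.
    by move=> x; rewrite rmorphB rmorphM rmorph1 /=; ring.
  have bh := bmfunZ (H z) bz; have bc := bmfun_conj bh.
  have bb := bmfunM bz (bmfun_conj bz).
  rewrite cintB; [|exact: bmfunZ|exact: bmfunD bh (bmfunB bc b1)].
  rewrite cintD//; last exact: bmfunB.
  rewrite cintB// cint_conj// !cintZ// cint_cst -cauchy_trE.
  by rewrite /recip_cauchy mulVf// rmorph1; ring.
rewrite Im_sub /recip_cauchy Im_inv Im_cauchy_tr//; ring.
Qed.

Lemma recip_cauchy_pick : pick H.
Proof.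
split=> [z z0|z w z0 w0].
  by rewrite -subr_ge0 -Im_sub Im_recip_sub ?gt_eqF// mulr_ge0 ?L2sq_ge0// ltW.
have [zn wn] : Im z != 0 /\ Im w != 0 by rewrite !gt_eqF.
rewrite recip_sub_kernel// !Im_recip_sub// Normc.normcM exprMn.
have b (u : C) : Im u != 0 -> bmfun (fun x => H u * cker u x - 1).
  move=> u0; apply: bmfunB (bmfun_cst 1).
  exact: bmfunZ _ (bmfun_cker u0).
have := cint_CauchySchwarz mu (b _ zn) (b _ wn).
move: (normc (cint _ _)) (L2sq _ _) (L2sq _ _) => N Q P h.
rewrite [leRHS](_ : _ = normc (z - w) ^+ 2 * (P * Q * (Im z * Im w))); last by ring.
rewrite [leLHS](_ : _ = normc (z - w) ^+ 2 * (N ^+ 2 * (Im z * Im w))); last by ring.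
rewrite ler_wpM2l ?sqr_ge0//.
by rewrite ler_wpM2r// mulr_ge0// ltW.
Qed.

(** Here [Im (H p) = Im p * t * |H p|^2], while [|G p| >= Im p * t] gives [|H p| <= 1 / (Im p * t)].
    Hence [Im (H p)] is at most [Im p / (Im p ^+ 2 * t)], and it remains to make [Im p ^+ 2 * t] at
    least [3 / 4]. *)
Lemma recip_cauchy_good_point :
  exists2 p : C, 0 < Im p & 3 * Im (H p) <= 4 * Im p.
Proof.
have [m m0 hm] := @probability_itv_ge (9 / 10) ltac:(lra).
pose p : C := Complex 0 (3 * m).
have p0 : 0 < Im p by rewrite /= mulr_gt0.
exists p => //.
have pn : Im p != 0 by rewrite gt_eqF.
set t := L2sq mu (cker p); have t0 : 0 < t by exact: L2sq_cker_gt0.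
(* On [[-m, m]] the squared distance to [p] is at most [10 * m ^+ 2], so the left factor
   [9 * m ^+ 2] and the mass [9 / 10] give [81 / 100]. *)
have ht : 3 / 4 <= Im p ^+ 2 * t.
  have h : (10 * m ^+ 2)^-1 * fine (mu `[- m, m]%classic) <= t.
    apply: L2sq_cker_ge => //.
      by rewrite invr_ge0 mulr_ge0 ?sqr_ge0.
    move=> x /=; rewrite in_itv /= => /andP[x1 x2].
    rewrite mulrC ler_pdivrMr ?mulr_gt0 ?exprn_gt0// mul1r; nra.
  have m2 : 0 < 10 * m ^+ 2 by rewrite mulr_gt0 ?exprn_gt0.
  have {}h := ler_wpM2l (ltW m2) h; rewrite mulVKf ?gt_eqF// in h.
  rewrite /=; nra.
have e : Im (H p) = Im p * t * normc (H p) ^+ 2.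
  by rewrite {1}/recip_cauchy Im_inv Im_cauchy_tr// -/t; ring.
have n0 : 0 <= normc (H p) ^+ 2 by exact: sqr_ge0.
have hn : normc (H p) ^+ 2 * (Im p * t) ^+ 2 <= 1.
  rewrite /recip_cauchy Normc.normcV exprVn mulrC.
  have g0 : 0 < normc (G p) ^+ 2 by rewrite exprn_gt0// normc_gt0 cauchy_tr_neq0.
  rewrite ler_pdivrMr// mul1r sqr_normc_def Im_cauchy_tr// -/t mulNr sqrrN.
  by rewrite lerDr sqr_ge0.
rewrite e; move: (normc (H p) ^+ 2) n0 hn => N n0 hn.
move: (Im p) p0 ht hn => y y0 ht hn.
have h1 : 3 / 4 * (N * t) <= 1.
  have := ler_wpM2r (mulr_ge0 n0 (ltW t0)) ht; nra.
nra.
Qed.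

End CauchyKernel.

Lemma inf_div_recip_injective (R : realType) (nu : probability R R) (z w : R[i]) :
  monotone_inf_div nu -> 0 < complex.Im z -> 0 < complex.Im w ->
  recip_cauchy nu z = recip_cauchy nu w -> z = w.
Proof.
move=> dnu; have [p p0 hp] := recip_cauchy_good_point nu.
apply: (pick_roots_injective p0 hp) => k k0.
have [mu hmu] := dnu k k0; exists (recip_cauchy mu); first exact: recip_cauchy_pick.
by move=> [u v] v0; exact: hmu.
Qed.

(** * Local inversion at an isolated atom *)

Section Contraction.
Variable R : realType.
Local Notation normc := (@Normc.normc R).

(** Lets an estimate valid at every stage of an iteration pass to the limit. *)
Lemma le_geometric_slack (x y c : R) :
  (forall n : nat, x <= y + c / 2 ^+ n) -> x <= y.
Proof.
move=> h; rewrite leNgt; apply/negP => yx.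
have d0 : 0 < x - y by rewrite subr_gt0.
have [n hn] : exists n : nat, c / (x - y) < n%:R.
  by exists (Num.truncn (c / (x - y))).+1; exact: truncnS_gt.
have n2 : n%:R <= 2 ^+ n :> R by rewrite -natrX ler_nat ltnW// ltn_expl.
have p2 : 0 < 2 ^+ n :> R by rewrite exprn_gt0.
have : c / 2 ^+ n < x - y.
  by rewrite ltr_pdivrMr// mulrC -ltr_pdivrMr//; exact: lt_le_trans n2.
have := h n; lra.
Qed.

(** The intervals of half-width [2 * d n] about [x n] are nested, because [d] halves at each step;
    the limit is the supremum of their left ends. *)
Lemma geometric_limit (x : nat -> R) (c : R) :
  (forall n, `|x n.+1 - x n| <= c / 2 ^+ n) ->
  exists l, forall n, `|l - x n| <= 2 * c / 2 ^+ n.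
Proof.
move=> hx; pose d n := c / 2 ^+ n.
have dS n : d n.+1 = d n / 2 by rewrite /d exprS invfM mulrCA mulrC.
have d0 n : 0 <= d n by exact: le_trans (hx n).
pose lo n := x n - 2 * d n; pose hi n := x n + 2 * d n.
have loS n : lo n <= lo n.+1.
  by have := hx n; rewrite -/(d n) ler_norml /lo dS => /andP[h1 h2]; lra.
have hiS n : hi n.+1 <= hi n.
  by have := hx n; rewrite -/(d n) ler_norml /hi dS => /andP[h1 h2]; lra.
have lom m n : (m <= n)%N -> lo m <= lo n.
  by move=> /subnK <-; elim: (n - m)%N => //= k ih; exact: le_trans ih (loS _).
have him m n : (m <= n)%N -> hi n <= hi m.
  by move=> /subnK <-; elim: (n - m)%N => //= k ih; exact: le_trans (hiS _) ih.
have lohi m n : lo m <= hi n.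
  apply: (@le_trans _ _ (lo (maxn m n))); first by rewrite lom// leq_maxl.
  apply: (@le_trans _ _ (hi (maxn m n))); last by rewrite him// leq_maxr.
  by have := d0 (maxn m n); rewrite /lo /hi; lra.
exists (sup (range lo)) => n; rewrite -mulrA -/(d n) ler_norml.
have ub : has_ubound (range lo) by exists (hi 0%N) => _ [m _ <-].
have h1 : lo n <= sup (range lo) by apply: ub_le_sup => //; exists n.
have h2 : sup (range lo) <= hi n.
  by apply: ge_sup; [exists (lo 0%N), 0%N|move=> _ [m _ <-]].
by move: h1 h2; rewrite /lo /hi => h1 h2; apply/andP; split; lra.
Qed.

Lemma normc_le_ReIm (z : R[i]) : normc z <= `|complex.Re z| + `|complex.Im z|.
Proof.
rewrite -ler_sqr ?nnegrE ?normc_ge0 ?addr_ge0// sqr_normc_def sqrrD.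
rewrite !real_normK ?num_real// lerD2r lerDl.
by rewrite mulrn_wge0// mulr_ge0.
Qed.

(** Banach's fixed-point theorem on a closed disc with ratio [1 / 2]. The iterates from the centre
    converge in each coordinate, which accounts for the factor 4 in the error. *)
Lemma complex_contraction (T : R[i] -> R[i]) (a : R[i]) (r : R) :
    (forall z, normc (z - a) <= r -> normc (T z - a) <= r) ->
    (forall z w, normc (z - a) <= r -> normc (w - a) <= r ->
      normc (T z - T w) <= normc (z - w) / 2) -> 0 <= r ->
  exists2 z, normc (z - a) <= r & T z = z.
Proof.
move=> Tball Tlip r0; pose u n := iter n T a.
have ub n : normc (u n - a) <= r.
  by elim: n => [|n ih]; [rewrite subrr Normc.normc0|exact: Tball].
have uS n : normc (u n.+1 - u n) <= r / 2 ^+ n.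
  elim: n => [|n ih]; first by rewrite expr0 divr1; exact: (ub 1%N).
  apply: (le_trans (Tlip _ _ (ub n.+1) (ub n))).
  by rewrite exprS invfM [_^-1 * _]mulrC mulrA ler_pM2r.
have [x hx] : exists l, forall n, `|l - complex.Re (u n)| <= 2 * r / 2 ^+ n.
  apply: (@geometric_limit (fun n => complex.Re (u n))) => n; apply: le_trans (uS n).
  apply: le_trans (Re_le_normc _).
  by case: (u n.+1) (u n) => [? ?] [? ?].
have [y hy] : exists l, forall n, `|l - complex.Im (u n)| <= 2 * r / 2 ^+ n.
  apply: (@geometric_limit (fun n => complex.Im (u n))) => n; apply: le_trans (uS n).
  by rewrite -Im_sub; exact: Im_le_normc.
have hz n : normc (Complex x y - u n) <= 4 * r / 2 ^+ n.
  apply: (le_trans (normc_le_ReIm _)).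
  have -> : 4 * r / 2 ^+ n = 2 * r / 2 ^+ n + 2 * r / 2 ^+ n by lra.
  by apply: lerD; [move: (hx n)|move: (hy n)]; case: (u n).
have zb : normc (Complex x y - a) <= r.
  apply: (@le_geometric_slack _ _ (4 * r)) => n.
  have -> : Complex x y - a = (u n - a) + (Complex x y - u n) by ring.
  by apply: (le_trans (le_normcD _ _)); exact: lerD.
exists (Complex x y) => //; apply/eqP; rewrite -subr_eq0 -normc_eq0.
rewrite eq_le normc_ge0 andbT.
apply: (@le_geometric_slack _ _ (4 * r)) => n; rewrite add0r.
have -> : T (Complex x y) - Complex x y =
  (T (Complex x y) - T (u n)) - (Complex x y - u n.+1) by rewrite /=; ring.
apply: (le_trans (le_normcD _ _)); rewrite normcN.
apply: (@le_trans _ _ (2 * r / 2 ^+ n + 2 * r / 2 ^+ n)); last by lra.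
apply: lerD.
  apply: (le_trans (Tlip _ _ zb (ub n))).
  by have := hz n; lra.
apply: (le_trans (hz n.+1)).
by rewrite exprS invfM mulrA; lra.
Qed.

End Contraction.

(** * Splitting the Cauchy transform at the atom *)

Section Atom.
Variables (R : realType) (mu : probability R R) (a e : R).
Notation C := R[i].
Local Notation normc := (@Normc.normc R).
Local Notation Re := (@complex.Re R).
Local Notation Im := (@complex.Im R).
Notation G := (cauchy_tr mu).
Notation H := (recip_cauchy mu).
Hypothesis e0 : 0 < e.
Hypothesis hole : mu (oint a e `\ a) = 0%E.

Let c := fine (mu [set a]).
Hypothesis c0 : 0 < c.

Definition far : set R := ~` oint a e.

Let measurable_oint : measurable (oint a e).
Proof. exact: measurable_itv. Qed.

Let measurable_far : measurable far.
Proof. exact: measurableC. Qed.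

Lemma farP x : far x -> e <= `|x - a|.
Proof.
move=> fx; rewrite leNgt; apply/negP => h; apply: fx.
move: h; rewrite ltr_norml /oint /= in_itv /= => /andP[h1 h2].
by apply/andP; split; lra.
Qed.

(** The cut-off keeps the kernel bounded on the whole disc of radius [e / 2] about [a], real and
    lower points included; the fixed-point iteration below runs on such a full disc. *)
Definition fker (z : C) (x : R) : C := (\1_far x)%:C%C * cker z x.

Lemma fkerE z x : fker z x = if x \in far then cker z x else 0.
Proof. by rewrite /fker indicE; case: ifP; rewrite /= ?mul1r ?mul0r. Qed.

Lemma far_dist (z : C) x : normc (z - a%:C%C) <= e / 2 -> far x ->
  e / 2 <= normc (z - x%:C%C).
Proof.
move=> za /farP ax.
have : e <= normc (z - x%:C%C) + normc (z - a%:C%C).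
  apply: (le_trans ax); rewrite -(normcN (z - x%:C%C)).
  have -> : `|x - a| = normc (- (z - x%:C%C) + (z - a%:C%C)).
    have -> : - (z - x%:C%C) + (z - a%:C%C) = (x - a)%:C%C.
      by rewrite rmorphB /=; ring.
    by rewrite /= expr0n /= addr0 sqrtr_sqr.
  exact: le_normcD.
lra.
Qed.

Lemma fker_le z x : normc (z - a%:C%C) <= e / 2 -> normc (fker z x) <= 2 / e.
Proof.
move=> za; rewrite fkerE; case: ifPn => [/set_mem fx|_].
  have h := far_dist za fx; have d0 : 0 < e / 2 by rewrite divr_gt0.
  rewrite /cker Normc.normcV -[leRHS]invf_div lef_pV2 ?posrE//.
  exact: lt_le_trans h.
by rewrite Normc.normc0 divr_ge0// ltW.
Qed.

Lemma bmfun_fker z : normc (z - a%:C%C) <= e / 2 -> bmfun (fker z).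
Proof.
move=> za; have [m1 m2] := measurable_cker z.
have mi : measurable_fun setT (\1_far : R -> R) by exact: measurable_indic.
split.
- rewrite (_ : _ \o _ = (\1_far : R -> R) \* (Re \o cker z)).
    exact: measurable_funM.
  by apply/funext => x /=; rewrite /fker; case: (cker z x) => ? ? /=; ring.
- rewrite (_ : _ \o _ = (\1_far : R -> R) \* (Im \o cker z)).
    exact: measurable_funM.
  by apply/funext => x /=; rewrite /fker; case: (cker z x) => ? ? /=; ring.
- by exists (2 / e) => x; exact: fker_le.
Qed.

Lemma fker_sub z w x : normc (z - a%:C%C) <= e / 2 ->
  normc (w - a%:C%C) <= e / 2 ->
  fker z x - fker w x = (w - z) * (fker z x * fker w x).
Proof.
move=> za wa; rewrite !fkerE; case: ifPn => [/set_mem fx|_]; last by ring.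
have d0 : 0 < e / 2 by rewrite divr_gt0.
by apply: cker_sub; rewrite -normc_gt0; apply: lt_le_trans d0 _; exact: far_dist.
Qed.

Definition cauchy_far (z : C) : C := cint mu (fker z).
Notation g := cauchy_far.

Lemma cauchy_far_le z : normc (z - a%:C%C) <= e / 2 -> normc (g z) <= 2 / e.
Proof.
move=> za; apply: normc_cint_le; first exact: bmfun_fker.
by move=> x; exact: fker_le.
Qed.

Lemma cauchy_far_lip z w : normc (z - a%:C%C) <= e / 2 ->
  normc (w - a%:C%C) <= e / 2 ->
  normc (g z - g w) <= (2 / e) ^+ 2 * normc (z - w).
Proof.
move=> za wa; have [bz bw] := (bmfun_fker za, bmfun_fker wa).
rewrite /g -cintB// (@eq_cint _ _ _ (fun x => (w - z) * (fker z x * fker w x))).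
  rewrite cintZ; last exact: bmfunM.
  rewrite Normc.normcM normc_distC mulrC ler_wpM2r ?normc_ge0//.
  apply: normc_cint_le; first exact: bmfunM.
  by move=> x; rewrite Normc.normcM expr2 ler_pM ?normc_ge0 ?fker_le.
by move=> x; exact: fker_sub.
Qed.

Lemma Im_cauchy_far z : normc (z - a%:C%C) <= e / 2 ->
  Im (g z) = - Im z * L2sq mu (fker z).
Proof.
move=> za; have za' : normc (conjc z - a%:C%C) <= e / 2.
  rewrite (_ : normc _ = normc (z - a%:C%C))//.
  by case: z {za} => u v /=; rewrite oppr0 !addr0 sqrrN.
have bz := bmfun_fker za.
have cf x : conjc (fker z x) = fker (conjc z) x.
  by rewrite !fkerE; case: ifP => _; [exact: cker_conj|rewrite conjc0].
have : g z - conjc (g z) = (conjc z - z) * (L2sq mu (fker z))%:C%C.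
  rewrite /g -cint_mul_conj -cint_conj// -cintB//; last exact: bmfun_conj.
  rewrite -cintZ; last by apply: bmfunM => //; exact: bmfun_conj.
  by apply: eq_cint => x; rewrite !cf fker_sub.
move/(congr1 Im); move: (L2sq _ _) (g z) => L [p q].
by case: z {za za' bz cf} => u v /=; rewrite mulr0 add0r => h; lra.
Qed.

Lemma cint_ae (f h : R -> C) (N : set R) : bmfun f -> bmfun h ->
  measurable N -> mu N = 0%E -> (forall x, ~ N x -> f x = h x) ->
  cint mu f = cint mu h.
Proof.
move=> bf bh mN N0 fh; have [f1 f2 _] := bf; have [h1 h2 _] := bh.
apply/eqP; rewrite eq_complex /=; apply/andP; split; apply/eqP; congr fine;
  apply: ae_eq_integral => //; try exact/measurable_EFinP;
  exists N; split => // x /= /not_implyP[_] hne; apply: contrapT => /fh;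
  by move=> e1; apply: hne; rewrite e1.
Qed.

(** Off the null set [oint a e] minus [a], the kernel is its value at the atom plus its far part. *)
Lemma cauchy_tr_atom z : Im z != 0 -> normc (z - a%:C%C) <= e / 2 ->
  G z = c%:C%C / (z - a%:C%C) + g z.
Proof.
move=> z0 za; rewrite cauchy_trE /g.
have ma : measurable ([set a] : set R) by exact: measurable_set1.
have bi : bmfun (fun x => (\1_[set a] x : R)%:C%C).
  split.
  - by rewrite (_ : _ \o _ = \1_[set a]); [exact: measurable_indic|].
  - by rewrite (_ : _ \o _ = cst 0); [exact: measurable_cst|].
  - exists 1 => x; rewrite /= expr0n /= addr0 sqrtr_sqr indicE.
    by case: (_ \in _); rewrite ?normr1 ?normr0.
have -> : c%:C%C / (z - a%:C%C) =
    cint mu (fun x => cker z a * (\1_[set a] x : R)%:C%C).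
  rewrite cintZ// mulrC; congr (_ * _).
  apply/eqP; rewrite eq_complex /=; apply/andP; split; apply/eqP.
    by rewrite /Rintegral integral_indic// setIT.
  by rewrite (@Rintegral_probability_cst _ mu 0).
rewrite -cintD; [|exact: bmfunZ|exact: bmfun_fker].
apply: (@cint_ae _ _ (oint a e `\ a)) => //.
- exact: bmfun_cker.
- by apply: bmfunD; [exact: bmfunZ|exact: bmfun_fker].
- exact: measurableD.
move=> x hx; rewrite fkerE indicE.
have [/set_mem fx|nfx] := boolP (x \in far).
  rewrite memNset ?mulr0 ?add0r// => /= xa; apply: fx.
  by rewrite xa /oint /= in_itv /= gtrBl ltrDl e0.
have xa : x = a.
  apply: contrapT => xa; apply: hx; split => //.
  by apply: contrapT => fx; move/negP: nfx; apply; rewrite inE.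
by rewrite xa mem_set// mulr1 addr0.
Qed.

(** The equation [c / (z - a) + g z = 1 / w] is equivalent to [z = a + c * w / (1 - w * g z)], whose
    right side contracts the disc of radius [eps / 2] once [w] is small. *)
Lemma local_preimage (eps : R) : 0 < eps -> eps <= e / 2 ->
  exists2 delta : R, 0 < delta & forall w : C, 0 < Im w -> normc w <= delta ->
    exists z : C, [/\ 0 < Im z, normc (z - a%:C%C) < eps & H z = w].
Proof.
move=> eps0 epse; exists (eps / 8); first by rewrite divr_gt0.
move=> w w0 wd.
have c1 : c <= 1.
  have m1 := probability_le1 mu (measurable_set1 a).
  by rewrite -lee_fin fineK// ge0_fin_numE// (le_lt_trans m1)// ltry.
have nw0 : 0 <= normc w by exact: normc_ge0.
have ball z : normc (z - a%:C%C) <= eps / 2 -> normc (z - a%:C%C) <= e / 2.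
  by move=> h; lra.
pose D z := 1 - w * g z.
(* From [|w| <= e / 16] and [|g z| <= 2 / e] the product is at most [1 / 8]. *)
have Dge z : normc (z - a%:C%C) <= eps / 2 -> 1 / 2 <= normc (D z).
  move=> /ball za; have gz := cauchy_far_le za.
  have : normc (w * g z) <= 1 / 2.
    rewrite Normc.normcM.
    apply: (@le_trans _ _ ((e / 16) * (2 / e))); last first.
      by rewrite [leLHS](_ : _ = 1 / 8); [lra|field; rewrite gt_eqF].
    by rewrite ler_pM ?normc_ge0//; lra.
  have : normc (1 : C) <= normc (D z) + normc (w * g z).
    have {1}-> : (1 : C) = D z + w * g z by rewrite /D; ring.
    exact: le_normcD.
  rewrite Normc.normc1; lra.
have Dn0 z : normc (z - a%:C%C) <= eps / 2 -> D z != 0.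
  by move=> /Dge h; rewrite -normc_gt0; lra.
have DV z : normc (z - a%:C%C) <= eps / 2 -> normc (D z)^-1 <= 2.
  move=> /Dge h; rewrite Normc.normcV -[leRHS]invrK lef_pV2 ?posrE ?invr_gt0//.
    lra.
  lra.
have ncw : normc (c%:C%C * w) <= eps / 8.
  rewrite Normc.normcM /= expr0n /= addr0 sqrtr_sqr ger0_norm ?(ltW c0)//.
  by apply: le_trans wd; rewrite ler_piMl.
pose T z := a%:C%C + c%:C%C * w / D z.
have [|||z za Tz] := @complex_contraction R T a%:C%C (eps / 2).
- move=> z za; rewrite /T addrAC subrr add0r Normc.normcM.
  apply: (@le_trans _ _ (eps / 8 * 2)); last by lra.
  by rewrite ler_pM ?normc_ge0// DV.
- move=> z y za ya.
  have -> : T z - T y = c%:C%C * w * w * (g z - g y) / D z / D y.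
    by rewrite /T /D; field; rewrite (Dn0 z za) (Dn0 y ya).
  rewrite !Normc.normcM -Normc.normcM.
  have gl := cauchy_far_lip (ball _ za) (ball _ ya).
  have K : normc (c%:C%C * w) * normc w * normc (g z - g y) <=
      1 / 16 * normc (z - y).
    apply: (@le_trans _ _ (e / 16 * (e / 16) * ((2 / e) ^+ 2 * normc (z - y)))).
      rewrite ler_pM ?mulr_ge0 ?normc_ge0//.
      by rewrite ler_pM ?normc_ge0//; lra.
    rewrite [leLHS]mulrA ler_wpM2r ?normc_ge0//.
    by rewrite [X in X <= _](_ : _ = 1 / 64); [lra|field; rewrite gt_eqF].
  apply: (@le_trans _ _ (1 / 16 * normc (z - y) * 2 * 2)).
    apply: ler_pM; rewrite ?mulr_ge0 ?normc_ge0//; last exact: DV.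
    by apply: ler_pM; rewrite ?mulr_ge0 ?normc_ge0//; exact: DV.
  by have := normc_ge0 (z - y); lra.
- by rewrite divr_ge0// ltW.
exists z.
have Dz := Dn0 z za.
have wn0 : w != 0 by apply: contraTneq w0 => ->; rewrite ltxx.
have eq1 : z - a%:C%C = c%:C%C * w / D z by rewrite -{1}Tz /T; ring.
have cn0 : (c%:C%C : C) != 0 by rewrite eq_complex /= gt_eqF.
have q0 : z - a%:C%C != 0 by rewrite eq1 !mulf_neq0// invr_eq0.
have eqG : c%:C%C / (z - a%:C%C) + g z = w^-1.
  have -> : c%:C%C / (z - a%:C%C) = D z / w.
    by rewrite eq1; field; rewrite wn0 cn0 Dz.
  by rewrite /D; field.
(* The fixed point is only known to lie in the disc. Its half-plane is recovered from [Im w^-1],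
   which is negative and equals [- Im z] times a positive number. *)
have Imz : 0 < Im z.
  have : Im w^-1 < 0.
    rewrite Im_inv mulNr oppr_lt0 mulr_gt0// exprn_gt0// normc_gt0.
    by rewrite invr_eq0.
  have -> : Im w^-1 = - Im z * (c * normc ((z - a%:C%C)^-1) ^+ 2 + L2sq mu (fker z)).
    rewrite -eqG.
    have -> : Im (c%:C%C / (z - a%:C%C) + g z) =
      c * Im ((z - a%:C%C)^-1) + Im (g z).
      by case: (_^-1) (g z) => [? ?] [? ?] /=; ring.
    rewrite Im_inv Im_cauchy_far; last exact: ball.
    rewrite Im_sub /=; ring.
  rewrite mulNr oppr_lt0 pmulr_lgt0// ltr_wpDr ?L2sq_ge0//.
  by rewrite mulr_gt0// exprn_gt0// normc_gt0 invr_eq0.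
split => //; first by apply: (le_lt_trans za); lra.
rewrite /recip_cauchy cauchy_tr_atom ?gt_eqF//; last exact: ball.
by rewrite eqG invrK.
Qed.

Hypothesis Hinj : forall z w, 0 < Im z -> 0 < Im w -> H z = H w -> z = w.

(** If [H z] were too small, [local_preimage] would give a point near [a] with the same value of
    [H]; by injectivity this point is [z], which is far from [a]. *)
Lemma cauchy_tr_bounded_off_atom (eps : R) : 0 < eps ->
  exists2 M : R, 0 < M & forall z : C, 0 < Im z -> eps <= normc (z - a%:C%C) ->
    normc (G z) <= M.
Proof.
move=> eps0; pose eps' := Num.min eps (e / 2).
have eps'1 : eps' <= eps by rewrite ge_min lexx.
have eps'2 : eps' <= e / 2 by rewrite ge_min lexx orbT.
have eps'0 : 0 < eps' by rewrite lt_min eps0 divr_gt0.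
have [delta d0 hd] := local_preimage eps'0 eps'2.
exists delta^-1; first by rewrite invr_gt0.
move=> z z0 za; have gz : G z != 0 by rewrite cauchy_tr_neq0// gt_eqF.
rewrite -[normc _]invrK -Normc.normcV lef_pV2 ?posrE//; last first.
  by rewrite normc_gt0 invr_eq0.
rewrite leNgt; apply/negP => hlt.
have Hz0 : 0 < Im (H z).
  exact: lt_le_trans z0 (proj1 (recip_cauchy_pick mu) _ z0).
have [y [y0 ya Hy]] := hd _ Hz0 (ltW hlt).
have yz := Hinj y0 z0 Hy; move: ya; rewrite yz ltNge => /negP; apply.
exact: le_trans za.
Qed.

End Atom.

(** * Absolute continuity *)

Section LipschitzMeasure.
Variables (R : realType) (mu : probability R R).

(** Cover [B] by intervals of small total length. One that meets [B] at [u] lies in the interval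
    centred at [u] whose radius is its length, so its mass is at most [K] times that length. *)
Lemma lipschitz_null (B : set R) (K : R) : 0 <= K -> measurable B ->
    (forall u v, B u -> 0 < v ->
      (mu `[(u - v)%R, (u + v)%R]%classic <= (K * v)%:E)%E) ->
  (@lebesgue_measure R) B = 0%E -> mu B = 0%E.
Proof.
move=> K0 mB hK B0; apply/eqP; rewrite eq_le measure_ge0 andbT.
apply/lee_addgt0Pr => eta eta0; rewrite add0e.
(* Adding 1 keeps the denominator positive when [K = 0]. *)
pose eta' := eta / (K + 1).
have K1 : 0 < K + 1 by rewrite ltr_wpDl.
have eta'0 : 0 < eta' by rewrite divr_gt0.
have : ((@lebesgue_measure R) B < eta'%:E)%E by rewrite B0 lte_fin.
(* Unfolding exposes the infimum over countable covers by half-open intervals. *)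
rewrite /lebesgue_measure /lebesgue_stieltjes_measure /measure_extension.
move=> /ereal_inf_lt[_ [F [mF BF] <-] hF].
have mF' k : measurable (F k : set R).
  by have [[p q] _ <-] := mF k; exact: measurable_itv.
apply: (@le_trans _ _ (\sum_(k <oo) mu (F k `&` B))%E).
  apply: measure_sigma_subadditive => //.
  - by move=> k; exact: measurableI.
  - by move=> x Bx; have [k _ Fx] := BF x Bx; exists k.
apply: (@le_trans _ _ (\sum_(k <oo) K%:E * wlength idfun (F k))%E).
  apply: lee_nneseries => [k _ _|k _]; first exact: measure_ge0.
  have [[p q] _ /= e] := mF k; rewrite -e.
  have [->|/set0P[u [/= upq Bu]]] := eqVneq (`]p, q]%classic `&` B) set0.
    by rewrite measure0 mule_ge0// ?lee_fin// wlength_ge0.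
  move: upq; rewrite in_itv /= => /andP[pu uq].
  have pq : p < q by exact: lt_le_trans uq.
  rewrite wlength_itv_bnd ?(ltW pq)// -EFinM.
  apply: le_trans (hK u (q - p) Bu _); last by rewrite subr_gt0.
  apply: le_measure; rewrite ?inE; [|exact: measurable_itv|].
    by apply: measurableI => //; exact: measurable_itv.
  move=> x [/=]; rewrite !in_itv /= => /andP[px xq] _.
  by apply/andP; split; lra.
rewrite nneseriesZl; last by move=> *; exact: wlength_ge0.
apply: (@le_trans _ _ (K%:E * eta'%:E)%E).
  by rewrite lee_wpmul2l ?lee_fin// ltW.
rewrite -EFinM lee_fin /eta' mulrA ler_pdivrMr// mulrC ler_pM2l//.
by rewrite lerDl.
Qed.

End LipschitzMeasure.

(** * Null sets off the support *)

Section Support.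
Variables (R : realType) (mu : probability R R).

(** Each point of [A] lies in a null interval with rational endpoints, and there are countably many
    of these. *)
Lemma off_support_null (A : set R) : measurable A ->
  (forall x, A x -> ~ msupport mu x) -> mu A = 0%E.
Proof.
move=> mA hA.
pose I (p : rat * rat) : set R := `](ratr p.1), (ratr p.2)[%classic.
(* Codes of no pair, or of an interval of positive mass, are sent to the empty set, so every [F n]
   is null. *)
pose F n : set R := if unpickle n is Some p then
  (if mu (I p) == 0%E then I p else set0) else set0.
have mF n : measurable (F n) /\ mu (F n) = 0%E.
  rewrite /F; case: unpickle => [p|]; last by split => //; rewrite measure0.
  case: ifPn => [/eqP ->|_]; last by split => //; rewrite measure0.
  by split => //; exact: measurable_itv.
have AF : A `<=` \bigcup_n F n.
  move=> x Ax; have /existsNP[r /not_implyP[r0 hr]] := hA x Ax.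
  have mo : mu (oint x r) = 0%E.
    by apply/eqP; rewrite eq_le measure_ge0 andbT leNgt; exact/negP.
  have [|p] := @rat_in_itvoo _ (x - r) x; first by rewrite gtrBl.
  rewrite in_itv /= => /andP[p1 p2].
  have [|q] := @rat_in_itvoo _ x (x + r); first by rewrite ltrDl.
  rewrite in_itv /= => /andP[q1 q2].
  have I0 : mu (I (p, q)) = 0%E.
    apply/eqP; rewrite eq_le measure_ge0 andbT -mo; apply: le_measure.
    - by rewrite inE; exact: measurable_itv.
    - by rewrite inE; exact: measurable_itv.
    move=> y; rewrite /I /oint /= !in_itv /= => /andP[y1 y2].
    by rewrite (lt_trans p1 y1) (lt_trans y2 q2).
  have FI : F (pickle (p, q)) = I (p, q) by rewrite /F pickleK I0 eqxx.
  apply: (@bigcup_sup _ _ (pickle (p, q))); first exact: Logic.I.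
  by rewrite FI /I /= in_itv /= p2 q1.
apply/eqP; rewrite eq_le measure_ge0 andbT.
apply: (@le_trans _ _ (\sum_(k <oo) mu (F k))%E).
  by apply: measure_sigma_subadditive => // n; have [] := mF n.
by rewrite eseries0// => n _ _; have [] := mF n.
Qed.

End Support.

(** Within distance [v] of [u] the squared modulus of the kernel is at least [1 / (2 * v ^+ 2)], so
    [|Im (G z)|] is at least the mass divided by [2 * v]. *)
Lemma mass_le_cauchy_tr (R : realType) (mu : probability R R) (u v M : R) :
  0 < v -> Normc.normc (cauchy_tr mu (Complex u v)) <= M ->
  (mu `[(u - v)%R, (u + v)%R]%classic <= (2 * M * v)%:E)%E.
Proof.
move=> v0 hM; set A : set R := `[_, _]%classic.
have mA : measurable A by exact: measurable_itv.
have fA : mu A \is a fin_num.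
  by rewrite ge0_fin_numE// (le_lt_trans (probability_le1 mu mA))// ltry.
rewrite -(fineK fA) lee_fin.
have vn : complex.Im (Complex u v) != 0 by rewrite /= gt_eqF.
have v2 : 0 < 2 * v ^+ 2 by rewrite mulr_gt0 ?exprn_gt0.
have h : (2 * v ^+ 2)^-1 * fine (mu A) <= L2sq mu (cker (Complex u v)).
  apply: L2sq_cker_ge => //; first by rewrite invr_ge0 ltW.
  move=> x; rewrite /A /= in_itv /= => /andP[x1 x2].
  by rewrite mulrC ler_pdivrMr// mul1r; nra.
have : v * L2sq mu (cker (Complex u v)) <= M.
  apply: le_trans hM; apply: le_trans (Im_le_normc _).
  rewrite Im_cauchy_tr// mulNr normrN ger0_norm//.
  by rewrite mulr_ge0 ?L2sq_ge0// ltW.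
move=> hv; have {}h := ler_wpM2l (ltW v2) h.
rewrite mulVKf ?gt_eqF// in h; apply: (le_trans h).
have := ler_wpM2l (ltW v0) hv; nra.
Qed.

Theorem theorem3p5 (R : realType) (nu : probability R R) (a : R) :
  monotone_inf_div nu ->
  (0 < nu [set a])%E ->
  ~ @closure R^o (msupport nu `\ a) a ->
  (exists nu_ac : {measure set R -> \bar R},
      nu_ac `<< (@lebesgue_measure R) /\
      (forall A : set R, measurable A ->
         nu A = (nu [set a] * \d_a A + nu_ac A)%E) /\
      ~ msupport nu_ac a) /\
  [set u | msupport nu u /\ u <> a /\
     limf_esup (fun v : R => (Normc.normc (cauchy_tr nu (Complex u v)))%:E) (0^'+)
       = +oo%E] = set0.
Proof.
move=> dnu atom iso.
have ma : measurable ([set a] : set R) by exact: measurable_set1.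
have ma1 := probability_le1 nu ma.
have fa : nu [set a] \is a fin_num.
  by rewrite ge0_fin_numE// (le_lt_trans ma1)// ltry.
have c0 : 0 < fine (nu [set a]) by rewrite -lte_fin fineK.
have [e e0 he] : exists2 e : R, 0 < e &
    forall x, oint a e x -> x <> a -> ~ msupport nu x.
  move: iso => /existsNP[B /not_implyP[/nbhs_ballP[e /= e0 eB] hB]].
  exists e => // x xe xa sx; apply: hB; exists x; split => //.
  apply: eB; move: xe; rewrite /oint /= in_itv /= -ball_normE /= distrC.
  by rewrite ltr_norml => /andP[h1 h2]; apply/andP; split; lra.
have mo : measurable (oint a e : set R) by exact: measurable_itv.
have hole : nu (oint a e `\ a) = 0%E.
  apply: off_support_null; first exact: measurableD.
  by move=> x [xe xa]; exact: he.
have inj z w := @inf_div_recip_injective R nu z w dnu.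
have bound := cauchy_tr_bounded_off_atom e0 hole c0 inj.
have dist (u v : R) : `|u - a| <= Normc.normc (Complex u v - a%:C%C).
  by apply: le_trans (Re_le_normc _); rewrite /=.
split; last first.
  apply/seteqP; split => // u [_ [ua]]; rewrite /= => hlim.
  have ua0 : 0 < `|u - a| by rewrite normr_gt0 subr_eq0; exact/eqP.
  have [M M0 hM] := bound _ ua0.
  suff : (limf_esup (fun v : R => (Normc.normc (cauchy_tr nu (Complex u v)))%:E)
     (0^'+) <= M%:E)%E by rewrite hlim leye_eq.
  (* The limit superior is an infimum of suprema over neighbourhoods; the set of all [v > 0] is one
     of them, and the bound on [G] is uniform there. *)
  apply: (@le_trans _ _ (ereal_sup ((fun v : R =>
     (Normc.normc (cauchy_tr nu (Complex u v)))%:E) @` [set v | 0 < v]))).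
    apply: ereal_inf_lbound; exists [set v : R | 0 < v] => //.
    exact: nbhs_right_gt.
  apply: ge_ereal_sup => _ [v v0 <-]; rewrite lee_fin.
  by apply: hM => //; exact: dist.
have mac : measurable (~` [set a] : set R) by exact: measurableC.
(* The absolutely continuous part is [nu] restricted to the complement of the atom. *)
exists (mrestr nu mac); split; [|split].
- apply/null_content_dominatesP => N mN N0.
  have [M M0 hM] := bound e e0.
  (* A Lebesgue-null set is split along the hole: outside it the bound on [G] applies at every
     point, and inside only the atom carries mass. *)
  have mNfar : measurable (N `\` oint a e) by exact: measurableD.
  have Nfar0 : nu (N `\` oint a e) = 0%E.
    apply: (@lipschitz_null _ _ _ (2 * M)) => //.
    + by rewrite mulr_ge0// ltW.
    + move=> u v [_ ue] v0; apply: mass_le_cauchy_tr => //.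
      by apply: hM => //; apply: le_trans (dist _ _); exact: (@farP _ a e).
    + apply/eqP; rewrite eq_le measure_ge0 andbT -N0.
      by apply: le_measure; rewrite ?inE//; exact: subDsetl.
  apply/eqP; rewrite eq_le measure_ge0 andbT /mrestr.
  apply: (@le_trans _ _ (nu ((N `\` oint a e) `|` (oint a e `\ a)))).
    apply: le_measure; rewrite ?inE.
    + exact: measurableI.
    + by apply: measurableU => //; exact: measurableD.
    + move=> x [Nx xa]; have [xe|xe] := pselect (oint a e x).
        by right.
      by left.
  have mh : measurable (oint a e `\ a) by exact: measurableD.
  apply: (le_trans (measureU2 nu mNfar mh)).
  rewrite -[leRHS]adde0; apply: leeD; rewrite le_eqVlt; apply/orP; left.
    exact/eqP/Nfar0.
  exact/eqP/hole.
- move=> A mA.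
  rewrite [RHS](_ : _ = (nu [set a] * \d_a A + nu (A `\` [set a]))%E); last first.
    by rewrite setDE.
  rewrite (measureDI nu mA ma) addeC diracE; congr (_ + _)%E.
  have [/set_mem Aa|nAa] := boolP (a \in A).
    by rewrite mule1; congr (nu _); apply/seteqP; split => [x []|x ->].
  rewrite mule0 -(measure0 nu); congr (nu _); apply/seteqP; split => // x [Ax xa].
  by move/negP: nAa; apply; rewrite inE -xa.
(* The hole itself is a neighbourhood of [a] that is null for the restricted measure. *)
- move=> /(_ e e0); rewrite lt_neqAle => /andP[/eqP h _]; apply: h; symmetry.
  by transitivity (nu (oint a e `\ a)); [rewrite setDE|exact: hole].
Qed.
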